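(* Let $\varphi_\lambda:\mathbb{R}^n\times\mathbb{R}\to\mathbb{R}^n$, with $\lambda\in[0,1]$, be a (continuous) parametrized family of dissipative flows. Then the family is polar if and only if for every continuation $K_\lambda$ of the global attractor $K_0$ of $\varphi_0$ there exists $\lambda_0>0$ such that $K_\lambda$ is not a global attractor of $\varphi_\lambda$ for every $0<\lambda<\lambda_0$.
   Context: A parametrized family of flows $\varphi_\lambda$, $\lambda\in[0,1]$, on $M$ is assumed continuous: $(x,t,\lambda)\mapsto\varphi_\lambda(x,t)$ is continuous. For a flow write $xt=\varphi(x,t)$, $xI=\varphi(\{x\}\times I)$ and $UI=\varphi(U\times I)$. The omega-limit of $x$ is $\omega(x)=\bigcap_{t>0}\overline{x[t,\infty)}$. Dissipative: a flow is dissipative if $\omega(x)\neq\emptyset$ for each $x\in M$ and the closure of $\bigcup_{x\in M}\omega(x)$ is compact. Attractors: a compact invariant set $K$ is stable if every neighborhood $U$ of $K$ contains a neighborhood $V$ of $K$ with $V[0,\infty)\subset U$; it is attracting if there is a neighborhood $U$ of $K$ with $\emptyset\neq\omega(x)\subset K$ for every $x\in U$. An attractor is a compact invariant set that is both attracting and stable. Its region of attraction is $\mathcal{A}(K)=\{x\in M:\emptyset\neq\omega(x)\subset K\}$. $K$ is a global attractor if $\mathcal{A}(K)=M$. (A flow is dissipative if and only if it has a global attractor; the global attractor is unique.) Polar: a parametrized family of dissipative flows $\varphi_\lambda$ on $\mathbb{R}^n$, $\lambda\in[0,1]$, is polar if for every $L>0$ there is $\lambda_0>0$ such that for every $0<\lambda<\lambda_0$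 there are a bounded trajectory $\gamma_\lambda:\mathbb{R}\to\mathbb{R}^n$ of $\varphi_\lambda$ and a $t_\lambda<0$ such that $\|\gamma_\lambda(t)\|>L$ for every $t$ with $-\infty<t<t_\lambda$. Isolated invariant sets and continuation: a compact invariant set $K$ is isolated if it has an isolating neighborhood, i.e. a compact neighborhood $N$ of $K$ such that $K$ is the maximal invariant set in $N$. Let $J\subset[0,1]$ be a closed non-degenerate subinterval and, for each $\lambda\in J$, let $K_\lambda$ be an isolated invariant set for $\varphi_\lambda$. The family $(K_\lambda)_{\lambda\in J}$ is a continuation if for each $\lambda_0\in J$ and each isolating neighborhood $N_{\lambda_0}$ of $K_{\lambda_0}$ (for $\varphi_{\lambda_0}$) there is $\delta>0$ such that $N_{\lambda_0}$ is an isolating neighborhood of $K_\lambda$ (for $\varphi_\lambda$) for every $\lambda\in(\lambda_0-\delta,\lambda_0+\delta)\cap J$. It is then called a continuation of $K_{\lambda_0}$ for each $\lambda_0\in J$. A ''continuation $K_\lambda$ of $K_0$'' means a continuation $(K_\lambda)_{\lambda\in J}$ with $0\in J$, and statements about $K_\lambda$ for $0<\lambda<\lambda_0$ presuppose that $\lambda_0$ is small enough that these $\lambda$ lie in $J$. *)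

(* Defs.v *)
From HB Require Import structures.
From mathcomp Require Import all_boot all_order all_algebra.
From mathcomp Require Import all_classical all_reals all_analysis.

Set Implicit Arguments.
Unset Strict Implicit.
Unset Printing Implicit Defensive.

Import Order.TTheory GRing.Theory Num.Theory.
Import numFieldNormedType.Exports.

Local Open Scope classical_set_scope.
Local Open Scope ring_scope.

Section Flows.
Context {R : realType} {M : topologicalType}.
Implicit Types (phi : M -> R -> M) (K N : set M).

Definition is_flow phi : Prop :=
  [/\ continuous (fun p : M * R => phi p.1 p.2),
      forall x, phi x 0 = x &
      forall x s t, phi (phi x s) t = phi x (s + t)].

Definition omega_limit phi (x : M) : set M :=
  \bigcap_(t in [set t : R | 0 < t]) closure (phi x @` `[t, +oo[).

Definition dissipative phi : Prop :=
  [/\ is_flow phi,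
      forall x, omega_limit phi x !=set0 &
      compact (closure (\bigcup_(x in [set: M]) omega_limit phi x))].

Definition invariant phi K : Prop := forall x t, K x -> K (phi x t).

Definition stable phi K : Prop :=
  forall U, set_nbhs K U ->
    exists2 V, set_nbhs K V & forall (x : M) (t : R), V x -> 0 <= t -> U (phi x t).

Definition attraction_region phi K : set M :=
  [set x | omega_limit phi x !=set0 /\ omega_limit phi x `<=` K].

Definition attracting phi K : Prop :=
  exists2 U, set_nbhs K U & U `<=` attraction_region phi K.

Definition attractor phi K : Prop :=
  [/\ compact K, invariant phi K, attracting phi K & stable phi K].

Definition global_attractor phi K : Prop :=
  attractor phi K /\ attraction_region phi K = [set: M].

Definition maximal_invariant phi N K : Prop :=
  [/\ K `<=` N, invariant phi K &
      forall K', K' `<=` N -> invariant phi K' -> K' `<=` K].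

Definition isolating_nbhd phi K N : Prop :=
  [/\ compact N, set_nbhs K N & maximal_invariant phi N K].

Definition isolated_invariant phi K : Prop :=
  [/\ compact K, invariant phi K & exists N, isolating_nbhd phi K N].

Definition trajectory phi (gamma : R -> M) : Prop :=
  exists x, forall t, gamma t = phi x t.

End Flows.

(* Families over [0, 1] (or over J = [a, b]) are represented by functions on
   the whole of R; values at parameters outside the interval are irrelevant
   and never constrained. *)
Section Families.
Context {R : realType} {M : topologicalType}.
Implicit Types (phi : R -> M -> R -> M).

Definition continuous_family phi : Prop :=
  {within [set p : M * R * R | p.2 \in `[0, 1]],
    continuous (fun p => phi p.2 p.1.1 p.1.2)}.

Definition dissipative_family phi : Prop :=
  continuous_family phi /\
  forall lam : R, lam \in `[0, 1] -> dissipative (phi lam).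

Definition continuation phi (a b : R) (K : R -> set M) : Prop :=
  [/\ 0 <= a, a < b & b <= 1] /\
  (forall lam : R, lam \in `[a, b] -> isolated_invariant (phi lam) (K lam)) /\
  (forall lam0 : R, lam0 \in `[a, b] ->
   forall N, isolating_nbhd (phi lam0) (K lam0) N ->
     exists2 delta : R, 0 < delta &
       forall lam : R, lam \in `]lam0 - delta, lam0 + delta[ -> lam \in `[a, b] ->
         isolating_nbhd (phi lam) (K lam) N).

End Families.

Section Polar.
Context {R : realType} {n : nat}.

(* The library norm on 'rV[R]_n is the max norm, which induces the same
   topology and the same bounded sets as the Euclidean one. *)
Definition eucl_norm (x : 'rV[R]_n) : R := Num.sqrt (\sum_i x 0 i ^+ 2).

(* [lam0 <= 1] keeps the parameters 0 < lam < lam0 inside [0, 1]. *)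
Definition polar (phi : R -> 'rV[R]_n -> R -> 'rV[R]_n) : Prop :=
  forall L : R, 0 < L ->
    exists2 lam0 : R, 0 < lam0 <= 1 &
      forall lam : R, 0 < lam < lam0 ->
        exists (gamma : R -> 'rV[R]_n) (tlam : R),
          [/\ trajectory (phi lam) gamma, bounded_set (range gamma), tlam < 0 &
              forall t, t < tlam -> L < eucl_norm (gamma t)].

End Polar.

(* Main.v *)
Require Import Defs.
From HB Require Import structures.
From mathcomp Require Import all_boot all_order all_algebra.
From mathcomp Require Import all_classical all_reals all_analysis.
From mathcomp Require Import lra.

Import Order.TTheory GRing.Theory Num.Theory.
Import numFieldNormedType.Exports.

Local Open Scope classical_set_scope.
Local Open Scope ring_scope.

(** Why the theorem holds.

   A global attractor contains every bounded invariant set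
   ([global_attractor_max]).  Hence, if the family is polar and [K] continues
   the global attractor [K 0], enclose [K 0] in the interior of a closed ball.
   This ball isolates [K 0], so it contains [K lam] for small [lam], whereas
   polarity with [L] larger than the radius yields a bounded trajectory that
   leaves the ball.  A global attractor [K lam] would contain that trajectory.

   Conversely, let the family not be polar: some [L] is such that, for
   arbitrarily small [lam], every bounded trajectory of [phi lam] meets the ball
   of radius [L].  The argument runs through absorbing sets: compact sets [W]
   whose points are all in the interior of [W] from some common time on.
   - A dissipative flow has arbitrarily large absorbing closed balls
     ([dissipative_absorbing_nball]); take one of radius [r > L] for [phi 0].
   - It suffices to test absorption on a compact time interval, so [W] remains
     absorbing for [phi lam] with [lam] small ([absorbing_perturb]).
   - The maximal invariant sets of [W] then form a continuation
     ([inv_part_continuation]), because maximal invariant sets in a compact set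
     are upper semicontinuous in the parameter ([inv_part_usc]).
   - The maximal invariant set of an absorbing compact set that every orbit
     visits is the global attractor ([absorbing_global_attractor]).  For
     [lam = 0] every orbit visits the ball.  For the parameters given by the
     failure of polarity too: an omega-limit set is nonempty and consists of
     bounded trajectories, so it meets the ball of radius [L], which lies in
     the interior of [W].
   So this continuation consists of global attractors for arbitrarily small
   [lam].

   All uniformity statements come from the formulation of compactness as
   [near_covering]: what holds near each point of a compact set, for all
   sufficiently advanced values of a parameter, holds on the whole set for all
   sufficiently advanced values of the parameter. *)

Set Implicit Arguments.
Unset Strict Implicit.

(** * Flows, omega-limit sets and uniform absorption *)

Section FlowBasics.
Context {R : realType} {M : topologicalType}.
Implicit Types (phi : M -> R -> M) (x y : M) (s t : R) (C K N U V W : set M).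

Lemma flow_near phi x t U : is_flow phi -> nbhs (phi x t) U ->
  \forall x' \near x & t' \near t, U (phi x' t').
Proof. by move=> [+ _ _] => /(_ (x, t)) /[apply]. Qed.

Lemma flow_near_pt phi x t U : is_flow phi -> nbhs (phi x t) U ->
  \forall x' \near x, U (phi x' t).
Proof.
move=> hf /(flow_near hf)[[A B] [/= xA tB] AB].
by apply: filterS xA => z Az; apply: (AB (z, t)); split=> //; exact: nbhs_singleton.
Qed.

Lemma flowK phi x t : is_flow phi -> phi (phi x (- t)) t = x.
Proof. by move=> [_ h0 hD]; rewrite hD addNr h0. Qed.

Lemma flowB phi x s t : is_flow phi -> phi (phi x s) (t - s) = phi x t.
Proof. by move=> [_ _ hD]; rewrite hD addrC subrK. Qed.

Lemma omega_limitP phi x y : omega_limit phi x y <->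
  forall U s, nbhs y U -> exists2 t, s <= t & U (phi x t).
Proof.
split=> [oy U s Uy|H s /= s0 U Uy].
  have [/=|z [[t /=]]] := oy (Num.max s 1) _ U Uy.
    by rewrite lt_max ltr01 orbT.
  by rewrite in_itv/= andbT ge_max => /andP[st _] <- Uz; exists t.
have [t st Ut] := H U s Uy; exists (phi x t); split=> //; exists t => //=.
by rewrite in_itv/= st.
Qed.

Lemma omega_limit_enters phi x y V : omega_limit phi x y -> nbhs y V ->
  forall s, exists2 t, s <= t & nbhs (phi x t) V.
Proof.
by move=> /omega_limitP oy /nbhs_interior Vy s; have [t st Vt] := oy _ s Vy; exists t.
Qed.

Lemma omega_limit_invariant phi x : is_flow phi ->
  Defs.invariant phi (omega_limit phi x).
Proof.
move=> hf y t /omega_limitP oy; apply/omega_limitP => U s Uyt.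
have [r sr Ur] := oy _ (s - t) (flow_near_pt hf Uyt).
have [_ _ hD] := hf; move: Ur; rewrite /= hD => Ur.
by exists (r + t) => //; rewrite -lerBlDr.
Qed.

Lemma omega_limit_sub phi x C s : closed C ->
  (forall t, s <= t -> C (phi x t)) -> omega_limit phi x `<=` C.
Proof.
move=> cC xC y /omega_limitP oy; apply: cC => U Uy.
by have [t st Ut] := oy U s Uy; exists (phi x t); split => //; exact: xC.
Qed.

(** [B] is a set from which orbits stay in [P] after the delay [s]; by
    continuity the time at which the orbit of [x] enters [B] also works for the
    points near [x], and compactness of [C] makes it uniform. *)
Lemma uniform_absorption phi C B P s : is_flow phi -> compact C ->
  (forall x t, B x -> s <= t -> P (phi x t)) ->
  (forall x, C x -> exists t, nbhs (phi x t) B) ->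
  exists S, forall x t, C x -> S <= t -> P (phi x t).
Proof.
move=> hf /compact_near_coveringP cC BP CB.
have [|S [_ HS]] := cC R (nbhs +oo) (fun t x => P (phi x t)) _.
- move=> x Cx; have [r Br] := CB x Cx.
  near=> x' t => /=.
  rewrite -(flowB _ r t hf); apply: BP.
    by near: x'; exact: (flow_near_pt hf Br).
  rewrite lerBrDr; near: t; exact: nbhs_pinfty_ge (num_real _).
- exists (S + 1) => x t Cx St; apply: HS => //.
  by rewrite (lt_le_trans _ St)// ltrDl.
Unshelve. all: end_near. Qed.

(** If [x] in [K'] were outside [K], the complement of [x] would be a
    neighborhood of [K], into which stability and compactness of [C] push all
    of [C] from some time [S] on.  But [x] itself is the position at time [S]
    of a point of [K']. *)
Lemma global_attractor_max phi K K' C : hausdorff_space M -> is_flow phi ->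
  global_attractor phi K -> compact C -> K' `<=` C -> Defs.invariant phi K' ->
  K' `<=` K.
Proof.
move=> hT hf [[cK _ _ stK] regK] cC K'C K'inv x K'x.
apply: contrapT => nKx.
have [|V KV VU] := stK (~` [set x]).
  move=> y Ky; apply: open_nbhs_nbhs; split; last by move=> /= yx; apply: nKx; rewrite -yx.
  by apply: closed_openC; exact: (accessible_closed_set1 (hausdorff_accessible hT)).
have [|S HS] := @uniform_absorption phi C V (~` [set x]) 0 hf cC VU.
  move=> y _; have : attraction_region phi K y by rewrite regK.
  case=> -[z oz] /(_ _ oz) Kz.
  by have [t _ Vt] := omega_limit_enters oz (KV _ Kz) 0; exists t.
by have := HS (phi x (- S)) S (K'C _ (K'inv _ _ K'x)) (lexx _); apply; rewrite /= flowK.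
Qed.

(** * Maximal invariant sets and absorbing sets *)

Definition inv_part phi N : set M := [set x | forall t, N (phi x t)].

Lemma inv_part_invariant phi N : is_flow phi -> Defs.invariant phi (inv_part phi N).
Proof. by move=> [_ _ hD] x t Nx s; rewrite hD. Qed.

Lemma inv_part_sub phi N : is_flow phi -> inv_part phi N `<=` N.
Proof. by move=> [_ h0 _] x /(_ 0); rewrite h0. Qed.

Lemma inv_part_max phi N K : K `<=` N -> Defs.invariant phi K -> K `<=` inv_part phi N.
Proof. by move=> KN Kinv x Kx t; apply: KN; exact: Kinv. Qed.

Lemma inv_part_maximal phi N : is_flow phi -> maximal_invariant phi N (inv_part phi N).
Proof.
move=> hf; split; [exact: inv_part_sub|exact: inv_part_invariant|].
by move=> K'; exact: inv_part_max.
Qed.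

Lemma maximal_invariantE phi N K : is_flow phi -> maximal_invariant phi N K ->
  K = inv_part phi N.
Proof.
move=> hf [KN Kinv Kmax]; rewrite eqEsubset; split; first exact: inv_part_max.
by apply: Kmax; [exact: inv_part_sub|exact: inv_part_invariant].
Qed.

Lemma inv_part_compact phi N : hausdorff_space M -> is_flow phi -> compact N ->
  compact (inv_part phi N).
Proof.
move=> hT hf cN; apply: (subclosed_compact _ cN); last exact: inv_part_sub.
have Ncl := compact_closed hT cN.
move=> x clx t; apply: Ncl => U Uxt.
have [y [yN Uy]] := clx _ (flow_near_pt hf Uxt).
by exists (phi y t); split => //; exact: yN.
Qed.

Lemma inv_part_isolating phi N : is_flow phi -> compact N ->
  set_nbhs (inv_part phi N) N -> isolating_nbhd phi (inv_part phi N) N.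
Proof. by move=> hf cN nN; split => //; exact: inv_part_maximal. Qed.

Lemma inv_part_isolated phi N : hausdorff_space M -> is_flow phi -> compact N ->
  set_nbhs (inv_part phi N) N -> isolated_invariant phi (inv_part phi N).
Proof.
move=> hT hf cN nN; split; [exact: inv_part_compact|exact: inv_part_invariant|].
by exists N; exact: inv_part_isolating.
Qed.

Definition absorbing phi W s :=
  forall x t, W x -> s <= t -> nbhs (phi x t) W.

(** A point of the maximal invariant set is the position at time [s] of a point
    of [W]. *)
Lemma absorbing_nbhs phi W s : is_flow phi -> absorbing phi W s ->
  set_nbhs (inv_part phi W) W.
Proof.
move=> hf hW x xW; rewrite -(flowK x s hf).
by apply: hW => //; exact: xW.
Qed.

(** A point [x] of [W] outside the maximal invariant set leaves [W] at some time
    [r], possibly positive.  As [W] is absorbing, the orbit is then outside [W]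
    at all times less than [r - s].  By compactness there is [S] such that a
    point of [W] whose orbit was in [W] at a time before [- S] lies in [U];
    thus [W] is carried into [U] after the time [max S s].  Before that time,
    continuity on a compact time interval suffices. *)
Lemma absorbing_stable phi W s : hausdorff_space M -> is_flow phi ->
  compact W -> absorbing phi W s -> stable phi (inv_part phi W).
Proof.
move=> hT hf cW hW U KU.
have Wcl := compact_closed hT cW.
have [S HS] : exists S, forall x t, W x -> S <= t -> W (phi x (- t)) -> U x.
  have [|S [_ HS]] := (compact_near_coveringP W).1 cW R (nbhs +oo)
     (fun t x => W (phi x (- t)) -> U x) _.
  - move=> x Wx; have [xW|/existsNP[r nWr]] := pselect (inv_part phi W x).
      near=> x' t => /= _; near: x'; exact: KU.
    near=> x' t => /= Wx't.
    have : (~` W) (phi x' r).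
      near: x'; apply: (flow_near_pt (U := ~` W) hf); apply: open_nbhs_nbhs; split=> //.
      exact: closed_openC.
    (* Were the position at time [- t] in [W], so would be the one at time [r]. *)
    case; rewrite -(flowB _ (- t) r hf) opprK.
    apply: nbhs_singleton; apply: hW Wx't _.
    rewrite -lerBlDl; near: t; exact: nbhs_pinfty_ge (num_real _).
  exists (S + 1) => x t Wx St; apply: HS => //.
  by rewrite (lt_le_trans _ St)// ltrDl.
pose S' := Num.max S (Num.max s 0).
exists [set x | W x /\ forall t, t \in `[0, S'] -> U (phi x t)].
  move=> x Kx; apply: filterI; first exact: (absorbing_nbhs hf hW).
  apply: ((compact_near_coveringP _).1 (@segment_compact R 0 S') M (nbhs x)
     (fun x t => U (phi x t))) => t _.
  have /(flow_near hf) : nbhs (phi x t) U.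
    by apply: KU; exact: inv_part_invariant.
  case=> -[A B] [/= xA tB] AB; exists (B, A) => //= -[t' x'] [/= Bt' Ax'].
  exact: (AB (x', t')).
move=> x t [Wx Ux] t0; have [tS|St] := leP t S'.
  by apply: Ux; rewrite in_itv/= t0 tS.
move: St; rewrite !gt_max => /andP[St /andP[st _]].
apply: (HS _ t); [|exact: ltW|].
- by apply: nbhs_singleton; apply: hW => //; exact: ltW.
- by have [_ h0 hD] := hf; rewrite hD subrr h0.
Unshelve. all: end_near. Qed.

Lemma absorbing_global_attractor phi W s : hausdorff_space M -> is_flow phi ->
  compact W -> absorbing phi W s ->
  (forall x, omega_limit phi x !=set0) -> (forall x, exists t, W (phi x t)) ->
  global_attractor phi (inv_part phi W).
Proof.
move=> hT hf cW hW o0 vW.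
have reg : attraction_region phi (inv_part phi W) = setT.
  rewrite -subTset => x _; split=> //; have [r Wr] := vW x.
  apply: inv_part_max; last exact: omega_limit_invariant.
  apply: (@omega_limit_sub phi x W (r + s)); first exact: compact_closed.
  move=> t rst; rewrite -(flowB _ r t hf); apply: nbhs_singleton; apply: hW => //.
  by rewrite lerBrDl.
split => //; split; [exact: inv_part_compact|exact: inv_part_invariant| |].
  exists setT; last by rewrite reg.
  by move=> x _; exact: filterT.
exact: absorbing_stable hW.
Qed.

End FlowBasics.

(** * Dependence on the parameter *)

Section Families.
Context {R : realType} {M : topologicalType}.
Variable phi : R -> M -> R -> M.
Hypothesis cphi : continuous_family phi.
Hypothesis hflow : forall l, l \in `[0, 1] -> is_flow (phi l).
Hypothesis hT : hausdorff_space M.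
Implicit Types (l b : R) (N O W : set M).

(** Neighborhoods of [l] relative to the parameter interval, outside which the
    family is not constrained. *)
Let param l := within `[0, 1]%classic (nbhs l).

Lemma family_near l x t U : l \in `[0, 1] -> nbhs (phi l x t) U ->
  \forall p \near (x, t) & l' \near param l, U (phi l' p.1 p.2).
Proof.
move=> l01 Ux.
have /subspace_continuousP/(_ (x, t, l) l01 U Ux) := cphi.
case=> -[A B] [/= xA lB] AB; exists (A, [set l' | B l' /\ l' \in `[0, 1]]).
  by split => //=; rewrite /param /within/=; apply: filterS lB => z Bz z01.
by move=> [p l'] [/= Ap [Bl' l'01]]; exact: (AB (p, l')).
Qed.

Lemma param_ball l (Q : R -> Prop) : param l Q ->
  exists2 delta, 0 < delta &
    forall l', l' \in `]l - delta, l + delta[ -> l' \in `[0, 1] -> Q l'.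
Proof.
move=> /nbhs_ballP[d /= d0 dQ]; exists d => // l' l'd l'01.
by apply: dQ => //; rewrite ball_itv.
Qed.

(** Points of [W] are in the interior of [W] during [[s, 2s]] for all nearby
    parameters, by continuity and compactness; later times are reached by
    jumps of length [s], each of which ends in [W]. *)
Lemma absorbing_perturb l W s : l \in `[0, 1] -> compact W -> 0 < s ->
  absorbing (phi l) W s -> \forall l' \near param l, absorbing (phi l') W s.
Proof.
move=> l01 cW s0 hW.
have cWI := compact_setX cW (@segment_compact R s (s + s)).
have H : \forall l' \near param l, W `*` `[s, s + s] `<=`
    (fun p : M * R => nbhs (phi l' p.1 p.2) W).
  apply: ((compact_near_coveringP _).1 cWI R (param l)
    (fun l' p => nbhs (phi l' p.1 p.2) W)) => -[x t] [/= Wx].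
  rewrite in_itv/= => /andP[st _].
  by apply: (family_near (U := interior W)) => //; apply: nbhs_interior; apply: hW.
have I : \forall l' \near param l, l' \in `[0, 1] by exact: withinT.
near=> l'.
have hf : is_flow (phi l') by apply: hflow; near: l'.
have step x t : W x -> s <= t -> t <= s + s -> nbhs (phi l' x t) W.
  move=> Wx st ts; suff : W `*` `[s, s + s] `<=` (fun p : M * R => nbhs (phi l' p.1 p.2) W).
    by move/(_ (x, t)); apply; split=> //=; rewrite in_itv/= st.
  by near: l'.
have steps k : forall x t, W x -> s <= t -> t <= s + s *+ k.+1 -> nbhs (phi l' x t) W.
  elim: k => [x t|k IH x t Wx st ts]; first by rewrite mulr1n; exact: step.
  have [tss|sst] := leP t (s + s); first exact: step.
  rewrite -(flowB x s t hf); apply: IH.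
  - by apply: nbhs_singleton; apply: step => //; rewrite lerDl ltW.
  - by rewrite lerBrDr ltW.
  - by rewrite lerBlDr; move: ts; rewrite [s *+ k.+2]mulrSr; lra.
move=> x t Wx st; pose k := Num.bound (t / s).
apply: (steps k) => //.
have : t / s < k%:R by apply: archi_boundP; rewrite divr_ge0// ltW// (lt_le_trans s0).
rewrite ltr_pdivrMr// => tk; apply/ltW/(lt_le_trans tk).
by rewrite -[s *+ _]mulr_natl (mulrSr 1 k) mulrDl mul1r; lra.
Unshelve. all: end_near. Qed.

(** A point of [N] outside the maximal invariant set leaves the closed set [N] at
    some time; the same time serves for nearby points and parameters. *)
Lemma inv_part_usc l N O : l \in `[0, 1] -> compact N ->
  set_nbhs (inv_part (phi l) N) O ->
  \forall l' \near param l, set_nbhs (inv_part (phi l') N) O.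
Proof.
move=> l01 cN NO; have Ncl := compact_closed hT cN.
have H : \forall l' \near param l, N `<=`
    (fun x => inv_part (phi l') N x -> nbhs x O).
  apply: ((compact_near_coveringP _).1 cN R (param l)
    (fun l' x => inv_part (phi l') N x -> nbhs x O)) => x Nx.
  have [/NO/nbhs_interior xO|/existsNP[t nNt]] := pselect (inv_part (phi l) N x).
    by near=> x' l' => /= _; near: x'.
  have /(family_near l01)[[A B] [/= xA lB] AB] : nbhs (phi l x t) (~` N).
    by apply: open_nbhs_nbhs; split=> //; exact: closed_openC.
  case: xA => -[A1 A2] [/= xA1 tA2] A12; exists (A1, B) => //.
  move=> -[x' l'] [/= Ax' Bl'] /(_ t) Nx't.
  exfalso.
  apply: (AB (x', t, l') _ Nx't); split=> //=.
  by apply: (A12 (x', t)); split=> //; exact: nbhs_singleton.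
near=> l'.
have hf : is_flow (phi l') by apply: hflow; near: l'; exact: withinT.
move=> x xN; suff : N `<=` (fun x => inv_part (phi l') N x -> nbhs x O).
  by move/(_ x); apply => //; exact: (inv_part_sub hf xN).
by near: l'.
Unshelve. all: end_near. Qed.

(** If [N] isolates the maximal invariant set of [W] at [l], then upper
    semicontinuity, applied in both [N] and [W], puts the maximal invariant set
    of each of them inside the other for nearby parameters, so that the two
    coincide. *)
Lemma inv_part_continuation b W : 0 < b <= 1 -> compact W ->
  (forall l, l \in `[0, b] -> set_nbhs (inv_part (phi l) W) W) ->
  continuation phi 0 b (fun l => inv_part (phi l) W).
Proof.
move=> /andP[b0 b1] cW nW.
have b01 l : l \in `[0, b] -> l \in `[0, 1].
  by rewrite !in_itv/= => /andP[-> lb]; exact: le_trans lb b1.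
split; first by split.
split=> [l /[dup]/b01 l01 lb|l /[dup]/b01 l01 lb N [cN nN mN]].
  by apply: inv_part_isolated => //; [exact: hflow|exact: nW].
have E := maximal_invariantE (hflow l01) mN.
have NW : \forall l' \near param l, set_nbhs (inv_part (phi l') N) W.
  by apply: inv_part_usc => //; rewrite -E; exact: nW.
have WN : \forall l' \near param l, set_nbhs (inv_part (phi l') W) N.
  exact: inv_part_usc.
have [d d0 dH] := param_ball (filterI NW WN); exists d => // l' l'd /[dup] l'b /b01 l'01.
have [NWl WNl] := dH _ l'd l'01.
have hf := hflow l'01.
have -> : inv_part (phi l') W = inv_part (phi l') N.
  rewrite eqEsubset; split; apply: inv_part_max; try exact: inv_part_invariant.
    by move=> x /WNl/nbhs_singleton.
  by move=> x /NWl/nbhs_singleton.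
apply: inv_part_isolating => // x xN; apply: WNl; move: x xN.
apply: inv_part_max; last exact: inv_part_invariant.
by move=> x /NWl/nbhs_singleton.
Qed.

End Families.

(** * Absorbing balls of dissipative flows *)

Section RowVectors.
Context {R : realType} {n : nat}.
Implicit Types (x : 'rV[R]_n) (r L : R) (A : set 'rV[R]_n).

Lemma rV_hausdorff : hausdorff_space 'rV[R]_n.
Proof. exact: norm_hausdorff. Qed.

Definition nball r : set 'rV[R]_n := [set x | `|x| <= r].

Lemma nball_compact r : compact (nball r).
Proof.
apply: bounded_closed_compact.
  by exists r; split; [exact: num_real|move=> s rs x /= xr; exact: le_trans xr (ltW rs)].
apply: (@closed_comp _ _ (fun x : 'rV[R]_n => `|x|) [set s | s <= r]).
  by move=> x _; exact: norm_continuous.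
exact: closed_le.
Qed.

Lemma nball_nbhs r x : `|x| < r -> nbhs x (nball r).
Proof.
move=> xr; apply: (@filterS _ _ _ [set y : 'rV[R]_n | `|y| < r]).
  by move=> y; exact: ltW.
apply: open_nbhs_nbhs; split=> //.
apply: (@open_comp _ _ (fun y : 'rV[R]_n => `|y|) [set s | s < r]).
  by move=> y _; exact: norm_continuous.
exact: open_lt.
Qed.

Lemma bounded_sub_nball A : bounded_set A -> exists r, A `<=` nball r.
Proof. by move=> [r [_ Ar]]; exists (r + 1) => x; apply: Ar; rewrite ltrDl. Qed.

Lemma normr_le_eucl_norm x : `|x| <= eucl_norm x.
Proof.
rewrite [leLHS]/Num.norm/= mx_normrE; apply/bigmax_leP; split=> [|[i j] _ /=].
  exact: sqrtr_ge0.
rewrite ord1 -sqrtr_sqr ler_sqrt; last by apply: sumr_ge0 => k _; exact: sqr_ge0.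
by rewrite (bigD1 j)//= lerDl; apply: sumr_ge0 => k _; exact: sqr_ge0.
Qed.

Lemma eucl_norm_le r x : `|x| <= r -> eucl_norm x <= Num.sqrt (n%:R * r ^+ 2).
Proof.
move=> xr; rewrite ler_wsqrtr// mulr_natl.
rewrite -[X in _ *+ X]card_ord -sumr_const; apply: ler_sum => i _.
rewrite -real_normK ?num_real// ler_sqr ?nnegrE//; last exact: le_trans xr.
apply: le_trans xr; rewrite [leRHS]/Num.norm/= mx_normrE.
by apply/bigmax_geP; right => /=; exists (0, i).
Qed.

(** Let [B] be a ball whose interior contains all omega-limit sets.  Every orbit
    enters the interior of [B] after time 1, so by compactness orbits starting
    in [B] return to [B] after a time between 1 and some [T].  Their positive
    semi-orbits therefore consist of excursions of length at most [T] and stay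
    in a ball of some radius [p].  A larger ball is uniformly absorbed into
    the ball of radius [p]. *)
Lemma dissipative_absorbing_nball (phi : 'rV[R]_n -> R -> 'rV[R]_n) L :
  dissipative phi -> exists r s,
    [/\ L < r, 0 < s, absorbing phi (nball r) s &
        forall x, exists t, nball r (phi x t)].
Proof.
move=> [hf o0 /compact_bounded/bounded_sub_nball[m om]].
pose B := nball (m + 1).
have enter x : exists2 t, 1 <= t & nbhs (phi x t) B.
  have [y oy] := o0 x; apply: (omega_limit_enters oy); apply: nball_nbhs.
  by rewrite ltr_pwDr//; apply: om; apply: subset_closure; exists x.
have [T BT] : exists T, forall x, B x -> exists t, [/\ 1 <= t, t <= T & B (phi x t)].
  have [|T [_ HT]] := (compact_near_coveringP B).1 (@nball_compact _) R (nbhs +oo)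
     (fun T x => exists t, [/\ 1 <= t, t <= T & B (phi x t)]) _.
    move=> x Bx; have [t t1 Bt] := enter x.
    near=> x' T => /=; exists t; split; first exact: t1.
    - by near: T; exact: nbhs_pinfty_ge (num_real _).
    - by near: x'; exact: (flow_near_pt hf Bt).
  by exists (T + 1) => x Bx; apply: HT => //; rewrite ltrDl.
have [p Bp] : exists p, forall x t, B x -> 0 <= t -> t <= T -> `|phi x t| <= p.
  have [cf _ _] := hf.
  have /compact_bounded/bounded_sub_nball[p Hp] := continuous_compact
    (continuous_subspaceT cf)
    (compact_setX (@nball_compact (m + 1)) (@segment_compact R 0 T)).
  exists p => x t Bx t0 tT; apply: Hp; exists (x, t) => //; split=> //=.
  by rewrite in_itv/= t0.
(* Each return takes time at least 1, so [k] returns cover the times up to [k]. *)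
have Bpk k : forall x t, B x -> 0 <= t -> t <= k%:R -> `|phi x t| <= p.
  elim: k => [|k IH] x t Bx t0 tk; have [u [u1 uT Bu]] := BT x Bx.
    by apply: Bp => //; apply: (le_trans tk); lra.
  have [tu|ut] := leP t u; first by apply: Bp => //; exact: le_trans tu uT.
  rewrite -(flowB x u t hf); apply: IH => //; first by lra.
  by move: tk; rewrite mulrSr; lra.
have [S HS] : exists S, forall x t, nball (Num.max p L + 1) x -> S <= t -> nball p (phi x t).
  apply: (@uniform_absorption _ _ phi _ B (nball p) 0 hf (@nball_compact _)).
    by move=> x t Bx t0; apply: (Bpk (Num.bound t)) => //; exact/ltW/archi_boundP.
  by move=> x _; have [t _ Bt] := enter x; exists t.
exists (Num.max p L + 1), (Num.max S 1); split.
- by rewrite ltr_pwDr// le_max lexx orbT.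
- by rewrite lt_max ltr01 orbT.
- move=> x t Wx; rewrite ge_max => /andP[St _]; apply: nball_nbhs.
  by rewrite ltr_pwDr// le_max HS.
- move=> x; have [t _ /nbhs_singleton Bt] := enter x; exists t.
  have [_ h0 _] := hf; rewrite /nball/= -[phi x t]h0.
  by apply: ler_wpDr => //; rewrite le_max (Bpk 0)// .
Unshelve. all: end_near. Qed.

End RowVectors.

(** * The characterization of polar families *)

Unset Implicit Arguments.
Set Strict Implicit.

Theorem proposition14 (R : realType) (n : nat)
    (phi : R -> 'rV[R]_n -> R -> 'rV[R]_n)
    (hphi : dissipative_family phi) :
  polar phi <->
  (forall (a b : R) (K : R -> set 'rV[R]_n),
     continuation phi a b K -> 0 \in `[a, b] ->
     global_attractor (phi 0) (K 0) ->
     exists2 lam0 : R, 0 < lam0 <= b &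
       forall lam : R, 0 < lam < lam0 -> ~ global_attractor (phi lam) (K lam)).
Proof.
have [cphi dphi] := hphi.
have hflow l : l \in `[0, 1] -> is_flow (phi l) by move=> /dphi[].
have I0 : (0 : R) \in `[0, 1] by rewrite in_itv/= lexx ler01.
split=> [pol a b K [[a0 ab b1] [isoK contK]] ab0 gK0|H].
  have [[cK0 K0inv _ _] _] := gK0.
  have [m K0m] := bounded_sub_nball (compact_bounded cK0).
  have isoW : isolating_nbhd (phi 0) (K 0) (nball (m + 1)).
    split; first exact: nball_compact.
      by move=> x /K0m xm; apply: nball_nbhs; rewrite ltr_pwDr.
    split=> //.
      by move=> x /K0m /= xm; apply: ler_wpDr.
    move=> K' K'W K'inv.
    exact: (global_attractor_max rV_hausdorff (hflow _ I0) gK0 (@nball_compact _ _ _) K'W).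
  have [d d0 dH] := contK 0 ab0 _ isoW.
  (* A Euclidean radius beyond which no point of the ball of radius [m + 1] lies. *)
  pose L := Num.sqrt (n%:R * (m + 1) ^+ 2) + 1.
  have L0 : 0 < L by rewrite ltr_wpDl// sqrtr_ge0.
  have [l0 /andP[l00 l01] polL] := pol L L0.
  move: ab0; rewrite in_itv/= => /andP[a0' b0].
  have {}b0 : 0 < b by exact: le_lt_trans ab.
  exists (Num.min l0 (Num.min b d)).
    by rewrite !lt_min l00 b0 d0 !ge_min lexx orbT.
  move=> l /andP[lpos]; rewrite !lt_min => /andP[ll0 /andP[lb ld]] gK.
  have [|gam [tl [[x gE] bgam tl0 far]]] := polL l; first by rewrite lpos.
  have hf : is_flow (phi l).
    by apply: hflow; rewrite in_itv/= ltW//= (le_trans (ltW lb)).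
  have [q gq] := bounded_sub_nball bgam.
  have ginv : Defs.invariant (phi l) (range gam).
    move=> _ t [s _ <-]; exists (s + t) => //.
    by have [_ _ hD] := hf; rewrite !gE hD.
  have gK' := global_attractor_max rV_hausdorff hf gK (@nball_compact _ _ _) gq ginv.
  have [_ _ [KW _ _]] : isolating_nbhd (phi l) (K l) (nball (m + 1)).
    apply: dH; rewrite in_itv/=; first by rewrite !add0r ld andbT; lra.
    by rewrite (ltW lb) andbT; lra.
  have := far (tl - 1); rewrite gtrBl ltr01 => /(_ isT).
  have /KW/eucl_norm_le : K l (gam (tl - 1)) by apply: gK'; exists (tl - 1).
  by rewrite /L; lra.
apply: contrapT => npol.
(* The negation of polarity; taking [tlam = -1] in it is enough. *)
have [L L0 npolL] : exists2 L : R, 0 < L & forall l0, 0 < l0 <= 1 ->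
    exists2 l : R, 0 < l < l0 & forall y, bounded_set (range (phi l y)) ->
      exists t, eucl_norm (phi l y t) <= L.
  apply: contrapT => nL; apply: npol => L L0; apply: contrapT => nl0.
  apply: nL; exists L => // l0 l01; apply: contrapT => nl; apply: nl0.
  exists l0 => // l ll0; apply: contrapT => ng; apply: nl; exists l => // y yb.
  apply: contrapT => nt; apply: ng; exists (phi l y), (- 1); split=> //.
  - by exists y.
  - by move=> t _; rewrite ltNge; apply/negP => tL; apply: nt; exists t.
have [r [s [Lr s0 absr visr]]] := dissipative_absorbing_nball L (dphi _ I0).
have cW := @nball_compact R n r.
have [d d0 dH] := param_ball (absorbing_perturb cphi hflow I0 cW s0 absr).
pose b := Num.min (d / 2) 1.
have b0 : 0 < b by rewrite lt_min divr_gt0//=.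
have b1 : b <= 1 by rewrite ge_min lexx orbT.
have absb l : l \in `[0, b] -> l \in `[0, 1] /\ absorbing (phi l) (nball r) s.
  rewrite !in_itv/= => /andP[l0 lb].
  have l1 : l \in `[0, 1] by rewrite in_itv/= l0 (le_trans lb).
  split; first by rewrite in_itv/= in l1.
  apply: dH l1; rewrite in_itv/=; move: lb; rewrite le_min => /andP[lb _].
  by apply/andP; split; lra.
have cont : continuation phi 0 b (fun l => inv_part (phi l) (nball r)).
  apply: inv_part_continuation => //; first by rewrite b0.
  by move=> l /absb[l1 al]; exact: absorbing_nbhs (hflow _ l1) al.
have [||l0 /andP[l00 l0b] Hl0] := H _ _ _ cont.
- by rewrite in_itv/= lexx ltW.
- have [hf o0 _] := dphi _ I0.
  exact: (absorbing_global_attractor rV_hausdorff hf cW absr o0 visr).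
have [|l ll0 npl] := npolL l0; first by rewrite l00 (le_trans l0b).
apply: (Hl0 l ll0).
have [|l1 absl] := absb l.
  by move/andP: ll0 => [? ?]; rewrite in_itv/=; apply/andP; split; lra.
have [hf o0 co] := dphi l l1.
apply: (absorbing_global_attractor rV_hausdorff hf cW absl o0) => x.
have [y oy] := o0 x.
have oinv := omega_limit_invariant hf.
(* The trajectory of [y] stays in the omega-limit set of [x]; it is bounded and
   therefore meets the ball of radius [L]. *)
have [|t yt] := npl y.
  have [M HM] := bounded_sub_nball (compact_bounded co).
  have : range (phi l y) `<=` nball M.
    move=> _ [t _ <-]; apply: HM; apply: subset_closure; exists x => //; exact: oinv.
  move=> yM; exists M; split=> [|M' MM' z /yM zM].
    exact: num_real.
  exact: le_trans zM (ltW MM').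
have Wyt : nbhs (phi l y t) (nball r).
  by apply: nball_nbhs; apply: le_lt_trans Lr; exact: le_trans (normr_le_eucl_norm _) yt.
have [u _ /nbhs_singleton Wu] := omega_limit_enters (oinv _ _ t oy) Wyt 0.
by exists u.
Qed.
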